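(* Let $s\ge 1$ and $F,G_1,\ldots,G_s\in\mathbb{Z}[x]\setminus\{0\}$. Suppose that $F$ has a nonconstant intersective divisor $H\in\mathbb{Z}[x]$ (that is, $H$ divides $F$ in $\mathbb{Z}[x]$) such that $\gcd\left(H,\prod_{j=1}^s G_j\right)=1$ in $\mathbb{Q}[x]$. Then there is a constant $C=C(H,G_1,\ldots,G_s)$, depending only on $H,G_1,\ldots,G_s$, with the following properties. (i) If $A\subset\mathbb{N}$ is finite and $|A|>C$, then for infinitely many positive integers $n$, $$d_A(F(n))>\max_{1\le j\le s}d_A(G_j(n)).$$ (ii) If $A\subset\mathbb{N}$ is infinite, then $$\limsup_{n\to\infty}\left(d_A(F(n))-\max_{1\le j\le s}d_A(G_j(n))\right)=\infty.$$ Moreover, the integers $n$ in both assertions may be chosen so that $\prod_{j}G_j(n)\neq 0$.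
   Context: $\mathbb{N}=\{1,2,\ldots\}$. For $A\subset\mathbb{N}$ and $m\in\mathbb{Z}$, $d_A(m)=\#\{a\in A: a\mid m\}$, which may be infinite (in particular $d_A(0)=|A|$). A polynomial $H\in\mathbb{Z}[x]$ is intersective if for every integer $m\ge 1$ there exists $n\in\mathbb{Z}$ with $H(n)\equiv 0\pmod m$. In the limsup, $n$ runs over positive integers. *)

(* Defs.v *)
From mathcomp Require Import all_boot all_order all_algebra.
From mathcomp Require Import all_classical all_reals all_analysis.

Set Implicit Arguments.
Unset Strict Implicit.
Unset Printing Implicit Defensive.

Import Order.TTheory GRing.Theory Num.Theory.
Import numFieldNormedType.Exports.

Local Open Scope classical_set_scope.
Local Open Scope ring_scope.

Definition intersective (H : {poly int}) : Prop :=
  forall m : int, 1 <= m -> exists n : int, (H.[n] = 0 %[mod m])%Z.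

(* [%|] on {poly int} is pseudo-division, i.e. divisibility over the
   rationals, hence this explicit version. *)
Definition dvd_Zpoly (H F : {poly int}) : Prop :=
  exists Q : {poly int}, F = Q * H.

Definition polyQ (p : {poly int}) : {poly rat} :=
  map_poly (intr : int -> rat) p.

(* d_A(m); the value is +oo when infinitely many elements of A divide m. *)
Definition dA (R : realType) (A : set nat) (m : int) : \bar R :=
  counting [set a : nat | A a /\ (a%:Z %| m)%Z].

Definition max_dA (R : realType) (s : nat) (G : 'I_s -> {poly int})
    (A : set nat) (n : nat) : \bar R :=
  \big[maxe/-oo%E]_(j < s) dA R A (G j).[n%:Z].

(* When both terms are +oo the difference is -oo by the convention of \bar R.
   This needs some (G j).[n] = 0, so for nonzero G j it occurs for only finitely
   many n and does not affect the limsup. *)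
Definition dA_gap (R : realType) (s : nat) (F : {poly int})
    (G : 'I_s -> {poly int}) (A : set nat) (n : nat) : \bar R :=
  (dA R A F.[n%:Z] - max_dA R G A n)%E.

(* Main.v *)
Require Import Defs.
From mathcomp Require Import all_boot all_order all_algebra.
From mathcomp Require Import all_classical all_reals all_analysis.
From mathcomp Require Import ring lra zify.

(** Let P be the product of the G_j. A Bezout relation between H and P over the
    rationals gives U H + V P = r with integer polynomials U, V and a nonzero
    integer r. Everything follows from one statement
    ([few_divisors_of_coprime_values]): there is a constant C such that for every
    L > 0 there are arbitrarily large n for which L divides H(n), P(n) <> 0, and
    P(n) has at most C divisors. Indeed, let L be the product of some elements of A.
    They all divide F(n), as H(n) does, whereas each G_j(n) divides P(n) and so has
    at most C divisors. For a finite A with more than C elements use all of A; for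
    an infinite A use more and more elements.

    To find n, choose by intersectivity a residue class modulo a multiple m of L on
    which m divides H. If m is divisible enough, the relation U H + V P = r shows
    that the part of P(n) composed of primes dividing m divides r. It remains to
    find n in the class such that P(n) has a bounded number of prime factors not
    dividing m, with a bound that does not depend on m. This is a lower bound sieve:
    if P(n) has no prime factor below z other than those dividing m, and is
    itself at most a fixed power of z, then the number of its other prime factors
    is bounded.

    The sieve ([exists_unsieved]) is of Brun's type, in the form of Hooley's almost
    pure sieve. The primes are split into blocks, inclusion-exclusion is truncated
    by Bonferroni's inequalities in each block separately, and the truncation
    degrees are larger for blocks of smaller primes. It needs upper bounds only: the
    number of roots of a polynomial modulo a prime, and Chebyshev's bound for the
    number of primes in a dyadic interval ([count_dyadic_primes]), which keep the
    density of each block at most 1/2. *)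

Set Implicit Arguments.
Unset Strict Implicit.
Unset Printing Implicit Defensive.

Import Order.TTheory GRing.Theory Num.Theory.
Import numFieldNormedType.Exports.

Local Open Scope classical_set_scope.
Local Open Scope ring_scope.

(** * Combinations of elementary symmetric polynomials *)

Section ElementarySymmetric.
Variable I : eqType.
Implicit Types (c : nat -> rat) (x w : I -> rat) (l : seq I).

(** The combination of elementary symmetric polynomials e_k(x_i : i in l) with
    coefficients c k, computed by e_{k+1}(i :: l) = e_{k+1}(l) + x_i e_k(l).
    One definition covers three uses in the sieve: x an indicator gives the
    sieve weight at a point, x a local density gives its main term, and x the
    size of the moduli gives its error term. *)
Fixpoint elem_sym_comb c x l : rat :=
  if l is i :: l' then elem_sym_comb c x l' + x i * elem_sym_comb (c \o S) x l'
  else c 0%N.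

Definition elem_sym m := elem_sym_comb (fun i => (i == m)%:R).

(** The coefficients of a Bonferroni truncation of inclusion-exclusion. *)
Definition alt_coef m (i : nat) : rat := if (i <= m)%N then (-1) ^+ i else 0.

Lemma eq_elem_sym_comb c c' x l : c =1 c' -> elem_sym_comb c x l = elem_sym_comb c' x l.
Proof.
elim: l c c' => [|i l IH] c c' e /=; first exact: e.
by rewrite (IH _ _ e) (IH (c \o S) (c' \o S)) // => j /=; rewrite e.
Qed.

Lemma elem_sym_combD c c' x l :
  elem_sym_comb (fun i => c i + c' i) x l = elem_sym_comb c x l + elem_sym_comb c' x l.
Proof.
elim: l c c' => [//|i l IH] c c' /=.
by rewrite IH (IH (c \o S) (c' \o S)); ring.
Qed.

Lemma elem_sym_combZ a c x l : elem_sym_comb (fun i => a * c i) x l = a * elem_sym_comb c x l.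
Proof.
elim: l c => [//|i l IH] c /=.
by rewrite IH (IH (c \o S)); ring.
Qed.

Lemma elem_sym_cons m x i l :
  elem_sym m.+1 x (i :: l) = elem_sym m.+1 x l + x i * elem_sym m x l.
Proof. by []. Qed.

Lemma elem_sym0 x l : elem_sym 0 x l = 1.
Proof.
have z l' : elem_sym_comb (fun=> 0) x l' = 0.
  by elim: l' => [//|i l' IH] /=; rewrite (eq_elem_sym_comb (c' := fun=> 0)) // IH mulr0 addr0.
elim: l => [//|i l IH].
rewrite /elem_sym /= -/(elem_sym 0 x l) IH (eq_elem_sym_comb (c' := fun=> 0)) //.
by rewrite z mulr0 addr0.
Qed.

Lemma elem_sym_nil m x : elem_sym m.+1 x [::] = 0.
Proof. by []. Qed.

Lemma elem_sym_comb_alt m x l :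
  elem_sym_comb (alt_coef m) x l = \sum_(i < m.+1) (-1) ^+ i * elem_sym i x l.
Proof.
elim: m => [|m IH].
  rewrite big_ord_recl big_ord0 addr0 expr0 mul1r /elem_sym.
  by apply: eq_elem_sym_comb => -[|i].
rewrite big_ord_recr /= -IH -elem_sym_combZ -elem_sym_combD; apply: eq_elem_sym_comb => i.
rewrite /alt_coef leq_eqVlt ltnS; case: eqP => [->|_] /=.
  by rewrite ltnn mulr1 add0r.
by rewrite mulr0 addr0.
Qed.

Lemma elem_sym_ge0 m x l : (forall i, 0 <= x i) -> 0 <= elem_sym m x l.
Proof.
move=> x0; elim: l m => [|i l IH] [|m]; rewrite ?elem_sym0 ?elem_sym_nil //.
by rewrite elem_sym_cons addr_ge0 // mulr_ge0.
Qed.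

(** Expanding (sum of the x_i) * e_m produces each monomial of e_{m+1} at
    least once. *)
Lemma elem_symS_le m x l : (forall i, 0 <= x i) ->
  elem_sym m.+1 x l <= (\sum_(i <- l) x i) * elem_sym m x l.
Proof.
move=> x0; elim: l m => [|i l IH] m; first by rewrite elem_sym_nil big_nil mul0r.
have s0 : 0 <= \sum_(j <- l) x j by apply: sumr_ge0.
rewrite elem_sym_cons big_cons addrC mulrDl lerD //.
  case: m => [|m]; first by rewrite !elem_sym0.
  by rewrite elem_sym_cons ler_wpM2l // lerDl mulr_ge0 // elem_sym_ge0.
apply: (le_trans (IH m)); rewrite ler_wpM2l //.
case: m => [|m]; first by rewrite !elem_sym0.
by rewrite elem_sym_cons lerDl mulr_ge0 // elem_sym_ge0.
Qed.

Lemma elem_sym_le m x l : (forall i, 0 <= x i) ->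
  elem_sym m x l <= (\sum_(i <- l) x i) ^+ m.
Proof.
move=> x0; elim: m => [|m IH]; first by rewrite elem_sym0.
apply: (le_trans (elem_symS_le m l x0)); rewrite exprS ler_wpM2l //.
exact: sumr_ge0.
Qed.

(** Since e_{2j+1} <= e_{2j} when the x_i have sum at most 1, the terms after
    1 - e_1 can be grouped in nonnegative pairs. *)
Lemma elem_sym_comb_alt_ge h x l : (forall i, 0 <= x i) -> \sum_(i <- l) x i <= 1 ->
  1 - \sum_(i <- l) x i <= elem_sym_comb (alt_coef h.*2) x l.
Proof.
move=> x0 s1; have s0 : 0 <= \sum_(j <- l) x j by apply: sumr_ge0.
have odd_ge h' : 1 - \sum_(i <- l) x i <= elem_sym_comb (alt_coef h'.*2.+1) x l.
  elim: h' => [|h' IH].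
    rewrite elem_sym_comb_alt !big_ord_recl big_ord0 /= expr0 expr1 elem_sym0.
    have := elem_symS_le 0 l x0; rewrite elem_sym0; rewrite /bump /=; lra.
  apply: (le_trans IH); rewrite !elem_sym_comb_alt doubleS !(big_ord_recr _.+2) /=.
  rewrite big_ord_recr /= -addrA lerDl !exprS -signr_odd odd_double expr0.
  have e0 := elem_sym_ge0 h'.*2.+2 l x0.
  have := elem_symS_le h'.*2.+2 l x0; have := ler_piMl e0 s1.
  by move=> a b; lra.
case: h => [|h].
  by rewrite elem_sym_comb_alt big_ord1 expr0 mul1r elem_sym0; lra.
apply: (le_trans (odd_ge h)); rewrite doubleS !elem_sym_comb_alt [leRHS]big_ord_recr /=.
by rewrite lerDl !exprS -signr_odd odd_double expr0 !mulN1r opprK mul1r elem_sym_ge0.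
Qed.

Lemma elem_sym_count m (S : pred I) l :
  elem_sym m (fun i => (S i)%:R) l = 'C(count S l, m)%:R.
Proof.
elim: l m => [|i l IH] [|m]; rewrite ?elem_sym0 ?bin0 ?elem_sym_nil //.
rewrite elem_sym_cons !IH /=; case: (S i) => /=.
  by rewrite mul1r add1n binS natrD.
by rewrite mul0r addr0.
Qed.

Lemma alt_bin_sum m X :
  \sum_(i < m.+1) (-1) ^+ i * 'C(X.+1, i)%:R = (-1) ^+ m * 'C(X, m)%:R :> rat.
Proof.
elim: m => [|m IH]; first by rewrite big_ord1 !bin0.
by rewrite big_ord_recr /= IH binS natrD exprS; ring.
Qed.

(** When X of the events hold, the truncated sum of (-1)^i C(X, i) telescopes
    by Pascal's rule to C(X - 1, 2h). So the truncated weight is 1 where no event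
    holds, and is nonnegative everywhere. *)
Lemma elem_sym_comb_alt_count h (S : pred I) l :
  elem_sym_comb (alt_coef h.*2) (fun i => (S i)%:R) l
  = if count S l is X.+1 then 'C(X, h.*2)%:R else 1.
Proof.
rewrite elem_sym_comb_alt; under eq_bigr => i _ do rewrite elem_sym_count.
case: (count S l) => [|X].
  by rewrite big_ord_recl /= big1 ?addr0 // => i _; rewrite bin0n mulr0.
by rewrite alt_bin_sum -signr_odd odd_double mul1r.
Qed.

(** Bounds the total size of the moduli that occur in a truncated weight of
    degree M. *)
Lemma elem_sym_comb_norm_le c M w l : (forall i, 0 <= w i) ->
  (forall i, `|c i| <= 1) -> (forall i, (M < i)%N -> c i = 0) ->
  0 <= elem_sym_comb (fun i => `|c i|) w l <= (1 + \sum_(i <- l) w i) ^+ M.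
Proof.
move=> w0; elim: l c M => [|i l IH] c M c1 cM /=.
  by rewrite normr_ge0 big_nil addr0 expr1n c1.
rewrite big_cons; have s0 : 0 <= \sum_(j <- l) w j by apply: sumr_ge0.
have [a1 a2] := andP (IH c M c1 cM).
have [b1 b2] : 0 <= elem_sym_comb ((fun i => `|c i|) \o S) w l /\
   w i * elem_sym_comb ((fun i => `|c i|) \o S) w l
    <= w i * (if M is M'.+1 then (1 + \sum_(j <- l) w j) ^+ M' else 0).
  case: M cM {a2} => [|M] cM.
    rewrite (eq_elem_sym_comb (c' := fun i => 0 * 0)) ?elem_sym_combZ ?mul0r //.
    by move=> j /=; rewrite cM ?normr0 ?mul0r.
  have := IH (c \o S) M (fun j => c1 _) (fun j h => cM j.+1 h).
  by move=> /andP[? ?]; split => //; rewrite ler_wpM2l.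
rewrite addr_ge0 ?mulr_ge0 //=; apply: (le_trans (lerD a2 b2)).
case: M {a2 b2 cM} => [|M]; first by rewrite !expr0 mulr0 addr0.
have wi := w0 i.
apply: (@le_trans _ _ ((1 + (w i + \sum_(j <- l) w j)) *
    (1 + \sum_(j <- l) w j) ^+ M)); last first.
  rewrite [leRHS]exprS ler_wpM2l //; first by lra.
  by rewrite lerXn2r ?nnegrE //; lra.
by rewrite exprS le_eqVlt; apply/orP; left; apply/eqP; ring.
Qed.
End ElementarySymmetric.

(** * Hooley's almost pure sieve *)

(** The product of the blocks is a linear combination of monomials in the
    indicators x t i. A monomial is a product over distinct indices, because the
    blocks are disjoint; so the approximation of the averages of monomials
    extends by linearity, and the errors add up to the same expression in w. The
    list V holds the indices already extracted from the blocks. *)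
Lemma sum_prod_elem_sym_comb_approx (I : eqType) (T : nat) (x : nat -> I -> rat)
    (nu w : I -> rat) (P : pred I) :
  (forall V, uniq V -> all P V ->
     `|\sum_(t < T) \prod_(i <- V) x t i - T%:R * \prod_(i <- V) nu i|
       <= \prod_(i <- V) w i) ->
  forall (ls : seq ((nat -> rat) * seq I)) V,
  uniq (V ++ flatten (map snd ls)) -> all P (V ++ flatten (map snd ls)) ->
  `|\sum_(t < T) (\prod_(i <- V) x t i * \prod_(b <- ls) elem_sym_comb b.1 (x t) b.2)
     - T%:R * (\prod_(i <- V) nu i * \prod_(b <- ls) elem_sym_comb b.1 nu b.2)|
  <= \prod_(i <- V) w i * \prod_(b <- ls) elem_sym_comb (fun n => `|b.1 n|) w b.2.
Proof.
move=> hyp; elim=> [|[c l] ls IHls] V.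
  rewrite /= cats0 => uV PV; rewrite !big_nil !mulr1.
  by under eq_bigr => t _ do rewrite big_nil mulr1; exact: hyp.
elim: l c V => [|i l IHl] c V /=.
  move=> uV PV; rewrite !big_cons /=.
  under eq_bigr => t _ do rewrite big_cons /= mulrCA.
  rewrite -mulr_sumr [X in _ - _ * X]mulrCA [X in _ - X]mulrCA -mulrBr normrM.
  by rewrite [leRHS]mulrCA ler_wpM2l // IHls.
move=> uV PV; rewrite !big_cons /=.
under eq_bigr => t _ do rewrite big_cons /=.
have pm : perm_eq (V ++ i :: l ++ flatten (map snd ls))
                  ((i :: V) ++ l ++ flatten (map snd ls)).
  by rewrite /= -cat_rcons perm_sym -cat_cons perm_cat2r perm_sym perm_rcons.
have PV2 : all P ((i :: V) ++ l ++ flatten (map snd ls)).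
  by rewrite -(perm_all P pm).
have := IHl (c \o S) (i :: V); rewrite -(perm_uniq pm) => /(_ uV PV2).
have uV1 : uniq (V ++ l ++ flatten (map snd ls)).
  by move: uV; rewrite (perm_uniq pm) /= => /andP[].
have PV1 : all P (V ++ l ++ flatten (map snd ls)) by case/andP: PV2.
have := IHl c V uV1 PV1.
rewrite !big_cons /=; under eq_bigr => t _ do rewrite big_cons /=.
under [in X in _ -> X -> _]eq_bigr => t _ do rewrite !big_cons /=.
move=> h1 h2; have := lerD h1 h2.
set A := \sum_(t < T) _; set B := \sum_(t < T) _; set C := \sum_(t < T) _.
have -> : C = A + B.
  by rewrite /A /B /C -big_split /=; apply: eq_bigr => t _; ring.
move=> h; apply: (le_trans _ (le_trans h _)).
  apply: (le_trans _ (ler_normD _ _)); rewrite le_eqVlt; apply/orP; left.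
  by apply/eqP; congr (`|_|); ring.
by rewrite le_eqVlt; apply/orP; left; apply/eqP; ring.
Qed.

(** Here S t i means that the event i holds at t, nu i is the density of that
    event, and the events of each block B k have total density at most 1/2. *)
Section Sieve.
Variables (I K : eqType) (ks : seq K) (B : K -> seq I) (h : K -> nat).
Variables (T : nat) (S : nat -> pred I) (nu w : I -> rat).
Hypothesis uks : uniq ks.
Hypothesis uB : uniq (flatten [seq B k | k <- ks]).
Hypothesis nu0 : forall i, 0 <= nu i.
Hypothesis w0 : forall i, 0 <= w i.
Hypothesis nuB : forall k, k \in ks -> \sum_(i <- B k) nu i <= 2^-1.
Hypothesis hsum : \sum_(k <- ks) 4^-1 ^+ h k <= 2^-1 :> rat.
Hypothesis level : forall V, uniq V ->
  all (mem (flatten [seq B k | k <- ks])) V ->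
  `|\sum_(t < T) \prod_(i <- V) (S t i)%:R - T%:R * \prod_(i <- V) nu i|
   <= \prod_(i <- V) w i.
Hypothesis Tbig :
  (1 + size ks)%:R * (\prod_(k <- ks) (1 + \sum_(i <- B k) w i) ^+ (h k).*2.+1)
  < T%:R * 2^-1 ^+ (size ks).+1.

Let tail m (i : nat) : rat := (i == m)%:R.
Let y k := alt_coef (h k).*2.
(* The factors of the product in which the block k0 has the weight b_k0. *)
Let z k0 k := if k == k0 then tail (h k).*2.+1 else y k.

Let one_prod (g : K -> nat -> rat) :
  (forall k i, `|g k i| <= 1) ->
  (forall k i, ((h k).*2.+1 < i)%N -> g k i = 0) ->
  `|\sum_(t < T) \prod_(k <- ks) elem_sym_comb (g k) (fun i => (S t i)%:R) (B k)
    - T%:R * \prod_(k <- ks) elem_sym_comb (g k) nu (B k)|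
  <= \prod_(k <- ks) (1 + \sum_(i <- B k) w i) ^+ (h k).*2.+1.
Proof.
move=> g1 gM.
have e : map snd [seq (g k, B k) | k <- ks] = [seq B k | k <- ks].
  by rewrite -map_comp.
have := @sum_prod_elem_sym_comb_approx I T (fun t i => (S t i)%:R) nu w _ level
   [seq (g k, B k) | k <- ks] [::].
rewrite cat0s e => /(_ uB (introT allP (fun i hi => hi))).
rewrite !big_nil !mul1r !big_map /=.
under eq_bigr => t _ do rewrite big_nil mul1r big_map /=.
move=> /le_trans; apply.
by apply: ler_prod => k _; apply: elem_sym_comb_norm_le (w0) (g1 k) (gM k).
Qed.

Let nuge k : k \in ks -> 2^-1 <= elem_sym_comb (y k) nu (B k).
Proof.
move=> kk; have hk := nuB kk.
apply: le_trans (elem_sym_comb_alt_ge (h k) nu0 _); lra.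
Qed.

Let y0 t k : 0 <= elem_sym_comb (y k) (fun i => (S t i)%:R) (B k).
Proof. by rewrite elem_sym_comb_alt_count; case: count. Qed.

(** Let y_k(t) >= 0 be the Bonferroni truncation of even degree for the block
    k, and let b_k(t) count the (2h+1)-element sets of events of the block k that
    hold at t. If some event of a block k holds at t, then y_k(t) <= b_k(t), hence
    prod_k y_k(t) <= sum_k b_k(t) prod_{k' <> k} y_k'(t). On average the left side
    is larger: the mean of y_k is at least 1/2 and that of b_k is at most
    (1/2)^(2h+1). So there is a t at which no event holds. *)
Lemma exists_unsieved : exists2 t, (t < T)%N &
  forall k i, k \in ks -> i \in B k -> ~~ S t i.
Proof.
pose Y c := \prod_(k <- ks) elem_sym_comb (y k) c (B k).
pose Z k0 c := \prod_(k <- ks) elem_sym_comb (z k0 k) c (B k).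
set D := \prod_(k <- ks) (1 + \sum_(i <- B k) w i) ^+ (h k).*2.+1.
pose X t : I -> rat := fun i => (S t i)%:R.
have c1 k i : `|y k i| <= 1.
  by rewrite /y /alt_coef; case: ifP => _; rewrite ?normr0 ?ler01 // normrX normrN1 expr1n.
have c2 k i : ((h k).*2.+1 < i)%N -> y k i = 0.
  by move=> /ltnW hi; rewrite /y /alt_coef leqNgt hi.
have EY : `|\sum_(t < T) Y (X t) - T%:R * Y nu| <= D.
  exact: one_prod.
have EZ k0 : `|\sum_(t < T) Z k0 (X t) - T%:R * Z k0 nu| <= D.
  apply: one_prod => k i; rewrite /z; case: eqP => _ //.
    by rewrite /tail; case: eqP => _; rewrite ?normr0 ?normr1.
  by rewrite /tail; case: eqP => // ->; rewrite ltnn.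
  exact: c2.
have Ynu : 2^-1 ^+ size ks <= Y nu.
  have -> : 2^-1 ^+ size ks = \prod_(k <- ks) 2^-1 :> rat.
    by rewrite big_const_seq count_predT iter_mulr_1.
  rewrite /Y !big_seq; apply: ler_prod => k kk.
  by rewrite invr_ge0 ler0n nuge.
have Y0 : 0 < Y nu by apply: lt_le_trans Ynu; rewrite exprn_gt0 ?invr_gt0.
have Znu : \sum_(k0 <- ks) Z k0 nu <= 2^-1 * Y nu.
  apply: (@le_trans _ _ (\sum_(k0 <- ks) 4^-1 ^+ h k0 * Y nu)); last first.
    by rewrite -mulr_suml ler_wpM2r // ltW.
  rewrite !big_seq; apply: ler_sum => k0 kk.
  rewrite /Z /Y (bigD1_seq k0) //= [in leRHS](bigD1_seq k0) //= mulrA.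
  have -> : \prod_(k <- ks | k != k0) elem_sym_comb (z k0 k) nu (B k)
          = \prod_(k <- ks | k != k0) elem_sym_comb (y k) nu (B k).
    by apply: eq_bigr => k /negbTE nk; rewrite /z nk.
  apply: ler_wpM2r.
    rewrite big_seq_cond; apply: prodr_ge0 => k /andP[kk' _].
    by apply: le_trans (nuge kk'); rewrite invr_ge0.
  rewrite /z eqxx; apply: (le_trans (elem_sym_le _ _ nu0)).
  apply: (@le_trans _ _ (2^-1 ^+ (h k0).*2.+1)).
    by rewrite lerXn2r ?nnegrE ?nuB ?sumr_ge0 ?invr_ge0.
  rewrite exprSr -mul2n exprM; apply: ler_pM; rewrite ?exprn_ge0 ?invr_ge0 ?nuge //.
(* The error terms, one for each of the 1 + size ks products, are beaten by
   half of the main term, which is at least T / 2 ^ size ks. *)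
have pos : 0 < \sum_(t < T) (Y (X t) - \sum_(k0 <- ks) Z k0 (X t)).
  rewrite sumrB exchange_big /=.
  have L1 : T%:R * Y nu - D <= \sum_(t < T) Y (X t).
    by have := EY; rewrite ler_distl => /andP[].
  have L2 : \sum_(k0 <- ks) \sum_(t < T) Z k0 (X t)
     <= \sum_(k0 <- ks) (T%:R * Z k0 nu + D).
    by apply: ler_sum => k0 _; have := EZ k0; rewrite ler_distl => /andP[].
  move: L2; rewrite big_split /= -mulr_sumr big_const_seq count_predT iter_addr_0.
  rewrite -mulr_natl => L2.
  have L3 : T%:R * \sum_(k0 <- ks) Z k0 nu <= T%:R * (2^-1 * Y nu).
    by rewrite ler_wpM2l.
  have L4 : T%:R * (2^-1 ^+ size ks) <= T%:R * Y nu by rewrite ler_wpM2l.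
  move: Tbig; rewrite -/D exprS natrD; lra.
have [t ht] : exists t : 'I_T, 0 < Y (X t) - \sum_(k0 <- ks) Z k0 (X t).
  apply/existsP; apply: contraLR pos; rewrite negb_exists => /forallP np.
  by rewrite -leNgt; apply: sumr_le0 => t _; rewrite leNgt.
exists t => // k i kk iB; apply/negP => Si.
have Y00 k' : 0 <= \prod_(j <- ks | j != k') elem_sym_comb (y j) (X t) (B j).
  by apply: prodr_ge0 => j _; exact: y0.
(* C(X - 1, 2h) <= C(X, 2h + 1) for X > 0, applied to the block k of i. *)
suff : Y (X t) <= \sum_(k0 <- ks) Z k0 (X t) by move: ht; lra.
apply: (@le_trans _ _ (Z k (X t))); last first.
  rewrite (bigD1_seq k) //= lerDl; apply: sumr_ge0 => k' _.
  apply: prodr_ge0 => j _; rewrite /z; case: eqP => _; last exact: y0.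
  by apply: elem_sym_ge0 => ?; rewrite ler0n.
rewrite /Y /Z (bigD1_seq k) //= [in leRHS](bigD1_seq k) //=.
rewrite [X in _ <= _ * X](eq_bigr (fun j => elem_sym_comb (y j) (X t) (B j))); last first.
  by move=> j /negbTE nj; rewrite /z nj.
apply: ler_wpM2r => //; rewrite /z eqxx /y elem_sym_comb_alt_count.
rewrite [leRHS]elem_sym_count.
have : (0 < count (S t) (B k))%N by rewrite -has_count; apply/hasP; exists i.
case: count => // X' _; rewrite ler_nat binS leq_addl //.
Qed.
End Sieve.

(** * Primes and roots of polynomials modulo integers *)

Lemma coprime_prod_primes p s : prime p -> all prime s -> p \notin s ->
  coprime p (\prod_(i <- s) i)%N.
Proof.
move=> pp; elim: s => [|i s IH] /=; first by rewrite big_nil coprimen1.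
case/andP=> pi ps; rewrite inE negb_or => /andP[npi nps].
by rewrite big_cons coprimeMr IH // prime_coprime // dvdn_prime2 // npi.
Qed.

Lemma prod_primes_dvdn n s : uniq s -> all prime s ->
  (\prod_(p <- s) p %| n)%N = all (fun p => p %| n)%N s.
Proof.
elim: s => [|p s IH] /=; first by rewrite big_nil dvd1n.
case/andP=> nps us /andP[pp ps]; rewrite big_cons Gauss_dvd ?IH //.
exact: coprime_prod_primes.
Qed.

Lemma prime_dvdn_fact p n : prime p -> (p %| n`!)%N = (p <= n)%N.
Proof.
move=> pp; apply/idP/idP => [|pn]; last by rewrite dvdn_fact ?prime_gt0.
elim: n => [|n IH]; first by rewrite dvdn1 => /eqP p1; rewrite p1 in pp.
by rewrite factS Euclid_dvdM // => /orP[/dvdn_leq->//|/IH/leqW].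
Qed.

Lemma bin_le_exp2 n m : ('C(n, m) <= 2 ^ n)%N.
Proof.
case: (leqP m n) => mn; last by rewrite bin_small.
rewrite -[2%N]/(1 + 1)%N expnDn (bigD1 (Ordinal (n:=n.+1) mn)) //=.
by rewrite !exp1n !muln1 leq_addr.
Qed.

(** Chebyshev's argument: for i > 1 the primes between 2^i and 2^(i+1) divide the
    central binomial coefficient C(2^(i+1), 2^i), which is at most 2^(2^(i+1)). *)
Lemma count_dyadic_primes i :
  (i * count prime (index_iota (2 ^ i) (2 ^ i.+1)) <= 2 ^ i.+1)%N.
Proof.
case: i => [|[|i]]; [by []|by []|]; move: i.+2 (isT : (1 < i.+2)%N) => {}i i1.
set n := (2 ^ i)%N; have n2 : (2 ^ i.+1 = n + n)%N by rewrite expnS mul2n addnn.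
set s := [seq p <- index_iota n (2 ^ i.+1) | prime p].
have ps : all prime s by apply/allP => p; rewrite mem_filter => /andP[].
have us : uniq s by rewrite filter_uniq ?iota_uniq.
have sn : all (leq n) s.
  by apply/allP => p; rewrite mem_filter mem_index_iota => /and3P[].
have npn : ~~ prime n.
  apply/negP => pn; have : (2 %| n)%N by rewrite dvdn_exp // ltnW.
  rewrite dvdn_prime2 // => /eqP e; move: i1.
  by rewrite -(ltn_exp2l 1 i (isT : 1 < 2)%N) -/n -e.
have dv : (\prod_(p <- s) p %| 'C(n + n, n))%N.
  rewrite prod_primes_dvdn //; apply/allP => p.
  rewrite mem_filter mem_index_iota n2 => /and3P[pp np pn].
  have ltnp : (n < p)%N.
    by rewrite ltn_neqAle np andbT; apply: contra npn => /eqP ->.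
  have : (p %| (n + n)`!)%N by rewrite prime_dvdn_fact // ltnW.
  rewrite -(@bin_fact (n + n) n) ?leq_addr // addnK !Euclid_dvdM // orbb.
  by rewrite prime_dvdn_fact // leqNgt ltnp orbF.
have : (n ^ size s <= 2 ^ (n + n))%N.
  apply: (@leq_trans (\prod_(p <- s) p)%N).
    elim: (s) sn => [|p s' IH] /=; first by rewrite big_nil.
    by case/andP=> np sn'; rewrite expnS big_cons leq_mul ?IH.
  apply: leq_trans (dvdn_leq _ dv) (bin_le_exp2 _ _).
  by rewrite bin_gt0 leq_addr.
by rewrite -expnM leq_exp2l // size_filter n2.
Qed.

Lemma sum_ord_periodic (f : nat -> nat) d T :
  (forall t, f (d + t)%N = f t) ->
  (\sum_(t < T) f t = T %/ d * \sum_(t < d) f t + \sum_(t < T %% d) f t)%N.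
Proof.
move=> fd; have sumT k r : (\sum_(t < k * d + r) f t
    = k * \sum_(t < d) f t + \sum_(t < r) f t)%N; last first.
  by rewrite -sumT -divn_eq.
elim: k => [|k IH]; first by rewrite mul0n.
rewrite mulSn -addnA big_split_ord /= mulSn -addnA; congr addn.
by rewrite -IH; apply: eq_bigr => t _; rewrite fd.
Qed.

(** The Chinese remainder theorem, in the form needed to multiply densities. *)
Lemma sum_ord_coprime (f g : nat -> nat) a b : (0 < a)%N -> (0 < b)%N ->
  coprime a b ->
  (forall t, f (t %% a)%N = f t) -> (forall t, g (t %% b)%N = g t) ->
  (\sum_(t < a * b) f t * g t = (\sum_(i < a) f i) * (\sum_(j < b) g j))%N.
Proof.
move=> a0 b0 co fa gb; rewrite big_distrlr pair_big /=.
have ab0 : (0 < a * b)%N by rewrite muln_gt0 a0.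
pose h (ij : 'I_a * 'I_b) : 'I_(a * b) :=
  Ordinal (ltn_pmod (chinese a b ij.1 ij.2) ab0).
pose h' (t : 'I_(a * b)) : 'I_a * 'I_b :=
  (Ordinal (ltn_pmod t a0), Ordinal (ltn_pmod t b0)).
have hK : cancel h h'.
  move=> [i j]; congr pair; apply: val_inj => /=.
    by rewrite modn_dvdm ?dvdn_mulr // chinese_modl // modn_small.
  by rewrite modn_dvdm ?dvdn_mull // chinese_modr // modn_small.
have h'K : cancel h' h.
  move=> t; apply: val_inj => /=; rewrite -[RHS](modn_small (ltn_ord t)).
  apply/eqP; rewrite chinese_remainder // chinese_modl // chinese_modr //.
  by rewrite !modn_mod !eqxx.
rewrite (reindex h) /=; last by exists h' => x _; [exact: hK|exact: h'K].
apply: eq_bigr => ij _ /=; congr muln.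
  by rewrite -fa modn_dvdm ?dvdn_mulr // chinese_modl // fa.
by rewrite -gb modn_dvdm ?dvdn_mull // chinese_modr // gb.
Qed.

Lemma dvdz_horner_sub (g : {poly int}) (x y : int) :
  (x - y %| g.[x] - g.[y])%Z.
Proof.
elim/poly_ind: g => [|g c IH]; first by rewrite !horner0 subrr dvdz0.
rewrite !hornerMXaddC.
have -> : g.[x] * x + c - (g.[y] * y + c) = (g.[x] - g.[y]) * x + g.[y] * (x - y).
  by ring.
by apply: rpredD; [exact: dvdz_mulr | exact: dvdz_mull].
Qed.

Lemma dvdz_horner_mod (g : {poly int}) (d x y : int) : (d %| x - y)%Z ->
  (d %| g.[x])%Z = (d %| g.[y])%Z.
Proof.
move=> /dvdz_trans /(_ (dvdz_horner_sub g x y)) h.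
by rewrite -[g.[x]](subrK g.[y]) rpredDl.
Qed.

Section RootCount.
Variable g : {poly int}.

Definition rho (d : nat) : nat := (\sum_(t < d) (d%:Z %| g.[t%:Z])%Z)%N.

Lemma dvdz_horner_add d t : (d%:Z %| g.[(d + t)%N%:Z])%Z = (d%:Z %| g.[t%:Z])%Z.
Proof. by apply: dvdz_horner_mod; rewrite PoszD addrK. Qed.

Lemma dvdz_horner_modn a d t : (d %| a)%N ->
  (d%:Z %| g.[(t %% a)%N%:Z])%Z = (d%:Z %| g.[t%:Z])%Z.
Proof.
move=> da; apply: dvdz_horner_mod; rewrite [X in _ - X%:Z](divn_eq t a).
have -> : (t %% a)%N%:Z - (t %/ a * a + t %% a)%N%:Z = - ((t %/ a)%N%:Z * a%:Z).
  by rewrite PoszD PoszM; ring.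
by rewrite rpredN; apply: dvdz_mull.
Qed.

Lemma rhoM a b : (0 < a)%N -> (0 < b)%N -> coprime a b ->
  rho (a * b) = (rho a * rho b)%N.
Proof.
move=> a0 b0 co; rewrite /rho -(@sum_ord_coprime (fun t => (a%:Z %| g.[t%:Z])%Z : nat)
  (fun t => (b%:Z %| g.[t%:Z])%Z : nat)) //.
- by apply: eq_bigr => t _; rewrite mulnb -Gauss_dvd // dvdzE /=.
- by move=> t; rewrite dvdz_horner_modn.
- by move=> t; rewrite dvdz_horner_modn.
Qed.

Lemma rho_prod s : uniq s -> all prime s ->
  rho (\prod_(p <- s) p) = (\prod_(p <- s) rho p)%N.
Proof.
elim: s => [|p s IH] /=.
  by rewrite !big_nil /rho big_ord1 dvd1z.
case/andP=> nps us /andP[pp ps]; rewrite !big_cons.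
have s0 : (0 < \prod_(i <- s) i)%N.
  by rewrite big_seq; apply: prodn_cond_gt0 => i /(allP ps)/prime_gt0.
by rewrite rhoM ?IH ?(prime_gt0 pp) ?coprime_prod_primes //.
Qed.

Lemma rho_le d : (rho d <= d)%N.
Proof.
rewrite -[X in (_ <= X)%N](card_ord d) -sum1_card; apply: leq_sum => t _.
by case: (_ %| _)%Z.
Qed.

(** The values divisible by d are periodic of period d; an incomplete period
    contributes at most rho d <= d. *)
Lemma count_roots_approx T d : (0 < d)%N ->
  `|(\sum_(t < T) (d%:Z %| g.[t%:Z])%Z)%N%:R - T%:R * ((rho d)%:R / d%:R)|
    <= d%:R :> rat.
Proof.
move=> d0; rewrite (@sum_ord_periodic (fun t => (d%:Z %| g.[t%:Z])%Z : nat) d);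
  last by move=> t; rewrite dvdz_horner_add.
rewrite -/(rho d); set c := (\sum_(t < _) _)%N.
have c0 : (c <= rho d)%N.
  rewrite /c /rho -!(big_mkord xpredT (fun t => (d%:Z %| g.[t%:Z])%Z : nat)).
  by rewrite [leqRHS](big_cat_nat (n := (T %% d)%N)) ?leq_addr //= ltnW // ltn_pmod.
have rd := rho_le d.
have cT : T%:R = (T %/ d)%:R * d%:R + (T %% d)%:R :> rat.
  by rewrite -natrM -natrD -divn_eq.
have md : (T %% d)%:R <= d%:R :> rat by rewrite ler_nat ltnW // ltn_pmod.
have d0' : d%:R != 0 :> rat by rewrite pnatr_eq0 -lt0n.
rewrite {}cT natrD natrM.
have -> : (T %/ d)%:R * (rho d)%:R + c%:R -
   ((T %/ d)%:R * d%:R + (T %% d)%:R) * ((rho d)%:R / d%:R)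
   = c%:R - (T %% d)%:R / d%:R * (rho d)%:R :> rat by field.
have q1 : (T %% d)%:R / d%:R <= 1 :> rat.
  by rewrite ler_pdivrMr ?mul1r // ltr0n.
have q0 : 0 <= (T %% d)%:R / d%:R :> rat by rewrite divr_ge0.
have := ler_piMl (ler0n rat (rho d)) q1.
have := mulr_ge0 q0 (ler0n rat (rho d)).
have r1 : (rho d)%:R <= d%:R :> rat by rewrite ler_nat.
have r2 : c%:R <= (rho d)%:R :> rat by rewrite ler_nat.
have r3 : 0 <= c%:R :> rat by [].
by rewrite ler_norml; move=> *; apply/andP; split; lra.
Qed.

(** Modulo p the polynomial does not vanish identically, so it has at most as
    many roots as its degree. *)
Lemma rho_prime_le p : prime p -> ~~ (p%:Z %| lead_coef g)%Z ->
  (rho p <= size g)%N.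
Proof.
move=> pp npl; pose gp : {poly 'F_p} := map_poly intr g.
have cp : p \in [pchar 'F_p] by apply: pchar_Fp.
have dv (x : int) : (x%:~R == 0 :> 'F_p) = (p%:Z %| x)%Z.
  rewrite dvdzE /= (dvdn_pcharf cp).
  by case: (intP x) => [|k|k]; rewrite ?mulrNz ?abszN ?oppr_eq0.
have lg : (lead_coef g)%:~R != 0 :> 'F_p by rewrite dv.
have gp0 : gp != 0.
  by rewrite -lead_coef_eq0 lead_coef_map_eq.
pose s : seq 'F_p := [seq (t%:R : 'F_p) | t <- iota 0 p & (p%:Z %| g.[t%:Z])%Z].
have us : uniq s.
  rewrite map_inj_in_uniq ?filter_uniq ?iota_uniq // => a b.
  rewrite !mem_filter !mem_iota /= !add0n => /andP[_ ap] /andP[_ bp] e.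
  have := congr1 val e; rewrite /= !val_Fp_nat //.
  by rewrite !modn_small.
have rs : all (root gp) s.
  apply/allP => _ /mapP[t + ->]; rewrite mem_filter => /andP[h _].
  by rewrite /root /gp -[t%:R]/(t%:Z%:~R) horner_map /= dv.
have := max_poly_roots gp0 rs us.
rewrite size_map size_map_poly_id0 // => /ltnW; apply: leq_trans.
rewrite size_filter -sum1_count big_mkcond /= /rho.
rewrite -(big_mkord xpredT (fun t => (p%:Z %| g.[t%:Z])%Z : nat)).
by rewrite /index_iota subn0 leq_sum.
Qed.
End RootCount.

(** * Sieving the values of a polynomial *)

Lemma uniq_flatten_fibers (I K : eqType) (f : I -> K) (s : seq I) (ks : seq K)
    (P : pred I) : uniq s -> uniq ks ->
  uniq (flatten [seq [seq i <- s | P i && (f i == k)] | k <- ks]).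
Proof.
move=> us; elim: ks => [//|k ks IH] /= /andP[nk uk].
rewrite cat_uniq filter_uniq // IH // andbT /=; apply/hasPn => i.
move=> /flattenP[_ /mapP[k' kk' ->]]; rewrite !mem_filter => /andP[/andP[_ /eqP e] _].
by apply: contra nk => /andP[/andP[_ /eqP <-] _]; rewrite e.
Qed.

Lemma ler_sum_uniq_subset (I : eqType) (f : I -> rat) (s s' : seq I) :
  (forall i, 0 <= f i) -> uniq s -> {subset s <= s'} ->
  \sum_(i <- s) f i <= \sum_(i <- s') f i.
Proof.
move=> f0; elim: s s' => [|x s IH] s' /=; first by rewrite big_nil sumr_ge0.
case/andP=> nx us ss'; rewrite big_cons [in leRHS](big_rem x) ?ss' ?mem_head //=.
rewrite lerD2l; apply: IH => // i si.
have := ss' i; rewrite inE si orbT => /(_ isT).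
rewrite (perm_mem (perm_to_rem (ss' x (mem_head _ _)))) inE => /orP[/eqP e|//].
by rewrite -e si in nx.
Qed.

(** The sieve is applied to the primes p with 2^q <= p < 2^(q 2^J) that do not
    divide the leading coefficient of g. Write l(p) for the integer part of the
    binary logarithm of p. The block (j, h) consists of the primes p such that
    2^j <= l(p) / q < 2^(j+1), with integer division, and l(p) = h modulo q.
    Grouping by j makes the sizes of the primes grow doubly exponentially, so that
    truncation degrees growing linearly as j decreases keep the level of the sieve
    a bounded power of 2^(2^J); splitting further by the residue h, with q at least
    4 times the size of g, brings the total density of each block down to 1/2. *)
Section SievePoly.
Variables (g : {poly int}) (q J : nat).
Hypothesis q0 : (0 < q)%N.
Hypothesis sg : (4 * size g <= q)%N.

Let good p := [&& prime p, (2 ^ q <= p)%N & ~~ (p%:Z %| lead_coef g)%Z].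
Let lg p := trunc_log 2 p.
Let cls p := (trunc_log 2 (lg p %/ q), (lg p %% q)%N).
Let N := (2 ^ (q * 2 ^ J))%N.
Let B k := [seq p <- iota 0 N | good p && (cls p == k)].
Let ks := [seq (j, h) | j <- iota 0 J, h <- iota 0 q].
(* Half the truncation degree: it grows as the primes get smaller, slowly enough
   for the level to stay a power of 2 ^ 2 ^ J and fast enough for [ht_sum]. *)
Let ht (k : nat * nat) := (q + (J - k.1.+1))%N.
Let nu p : rat := (rho g p)%:R / p%:R.
Let w p : rat := p%:R.

Let lgP p : (0 < p)%N -> (2 ^ lg p <= p < 2 ^ (lg p).+1)%N.
Proof. by move=> p0; apply: trunc_log_bounds. Qed.

Let nu_ge0 p : 0 <= nu p.
Proof. exact: divr_ge0. Qed.

Let good_gt0 p : good p -> (0 < p)%N.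
Proof. by case/and3P=> /prime_gt0. Qed.

Let lg_div p : good p ->
  let j := trunc_log 2 (lg p %/ q) in (2 ^ j <= lg p %/ q < 2 ^ j.+1)%N.
Proof.
move=> gp; apply: trunc_log_bounds => //; rewrite divn_gt0 //.
case/and3P: (gp) => _ qp _.
have /andP[_ h] := lgP (good_gt0 gp).
by rewrite -ltnS -(ltn_exp2l _ _ (isT : 1 < 2)%N) (leq_ltn_trans qp).
Qed.

Let mem_ks k : (k \in ks) = (k.1 < J)%N && (k.2 < q)%N.
Proof.
apply/allpairsP/idP => [[[j h] [/=]]|/andP[h1 h2]].
  by rewrite !mem_iota !add0n /= => h1 h2 ->; rewrite h1 h2.
by exists k; rewrite !mem_iota /=; split => //; case: (k).
Qed.

(** There are 2^j dyadic ranges in a block, of exponents i >= q 2^j; each has at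
    most 2^(i+1) / i primes, of density at most (size g) / 2^i. *)
Let nu_sum k : k \in ks -> \sum_(p <- B k) nu p <= 2^-1.
Proof.
case: k => j h; rewrite mem_ks /= => /andP[jJ hq].
pose d : rat := (size g)%:R.
pose s a := [seq p <- index_iota (2 ^ (a * q + h)) (2 ^ (a * q + h).+1) | prime p].
have qd : 4 * d <= q%:R by rewrite /d -natrM ler_nat.
have d0 : 0 <= d by [].
have q0' : 0 < q%:R :> rat by rewrite ltr0n.
apply: (@le_trans _ _ (\sum_(p <- B (j, h)) d / p%:R)).
  rewrite !big_seq; apply: ler_sum => p.
  rewrite mem_filter => /andP[/andP[/and3P[pp _ npl] _] _].
  by rewrite /nu ler_wpM2r ?invr_ge0 // ler_nat rho_prime_le.
apply: (@le_trans _ _ (\sum_(p <- flatten [seq s a | a <- iota (2 ^ j) (2 ^ j)]) d / p%:R)).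
  apply: ler_sum_uniq_subset => [p|//|p]; first by rewrite divr_ge0.
    by rewrite filter_uniq ?iota_uniq.
  rewrite mem_filter => /andP[/andP[gp /eqP [ej eh]] _].
  apply/flattenP; exists (s (lg p %/ q)%N); last first.
    rewrite mem_filter mem_index_iota -eh -divn_eq (lgP (good_gt0 gp)) andbT.
    by case/and3P: gp.
  apply/mapP; exists (lg p %/ q)%N => //; rewrite mem_iota.
  by have /= := lg_div gp; rewrite ej expnS mul2n addnn.
rewrite big_flatten big_map.
apply: (@le_trans _ _ (\sum_(a <- iota (2 ^ j) (2 ^ j)) 2^-1 / (2 ^ j)%:R)); last first.
  rewrite big_const_seq count_predT size_iota iter_addr_0 -[leLHS]mulr_natr.
  by rewrite mulfVK // pnatr_eq0 expn_eq0.
rewrite !big_seq; apply: ler_sum => a; rewrite mem_iota => /andP[ja _].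
set i := (a * q + h)%N.
have i0 : (2 ^ j * q <= i)%N by rewrite (leq_trans _ (leq_addr _ _)) // leq_mul2r ja orbT.
apply: (@le_trans _ _ (\sum_(p <- s a) d / (2 ^ i)%:R)).
  rewrite !big_seq; apply: ler_sum => p.
  rewrite mem_filter mem_index_iota => /and3P[_ ip _].
  rewrite ler_wpM2l // lef_pV2 ?posrE ?ltr0n ?expn_gt0 // ?ler_nat //.
  by apply: leq_trans ip; rewrite expn_gt0.
rewrite big_const_seq count_predT iter_addr_0 size_filter -[leLHS]mulr_natr.
have := count_dyadic_primes i; set n := count _ _ => hn.
have p0 : 0 < (2 ^ j)%:R :> rat by rewrite ltr0n expn_gt0.
have p1 : 0 < (2 ^ i)%:R :> rat by rewrite ltr0n expn_gt0.
have hn' : (2 ^ j)%:R * q%:R * n%:R <= 2 * (2 ^ i)%:R :> rat.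
  by rewrite -!natrM ler_nat -expnS (leq_trans _ hn) // leq_mul2r i0 orbT.
rewrite ler_pdivlMr // mulrAC -mulrA mulrAC ler_pdivrMr //.
have : (2 ^ j)%:R * n%:R * (4 * d) <= (2 ^ j)%:R * n%:R * q%:R :> rat.
  by rewrite ler_wpM2l // mulr_ge0.
rewrite (mulrAC _ n%:R q%:R) => h1; have h2 := le_trans h1 hn'.
lra.
Qed.

(** A geometric series, as q blocks share each value of j. *)
Let ht_sum : \sum_(k <- ks) 4^-1 ^+ ht k <= 2^-1 :> rat.
Proof.
rewrite big_allpairs /ht /=.
have geo n : \sum_(j < n) 4^-1 ^+ (n - j.+1) <= 2 :> rat.
  have : \sum_(j < n) 4^-1 ^+ (n - j.+1) <= 4 / 3 :> rat; last by lra.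
  elim: n => [|n IH]; first by rewrite big_ord0.
  rewrite big_ord_recr /= subnn expr0.
  have -> : \sum_(i < n) 4^-1 ^+ (n.+1 - i.+1)
     = 4^-1 * \sum_(i < n) 4^-1 ^+ (n - i.+1) :> rat.
    by rewrite mulr_sumr; apply: eq_bigr => i _; rewrite -exprS subSn.
  lra.
have q4 : q%:R * 4^-1 ^+ q <= 4^-1 :> rat.
  rewrite exprVn ler_pdivrMr ?exprn_gt0 //.
  case: (q) q0 => // n _; rewrite exprS mulKf //.
  by rewrite -(natrX _ 4 n) ler_nat; apply: ltn_expl.
have -> : iota 0 J = index_iota 0 J by rewrite /index_iota subn0.
under eq_bigr => j _ do
  rewrite big_const_seq count_predT size_iota iter_addr_0 exprD -mulrnAl -mulr_natl.
rewrite -mulr_sumr big_mkord.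
have := geo J; set G := \sum_(j < J) _ => hG.
have G0 : 0 <= G by apply: sumr_ge0 => i _; rewrite exprn_ge0.
have := ler_wpM2r G0 q4; lra.
Qed.

Let level_hyp T (V : seq nat) : uniq V ->
  all (mem (flatten [seq B k | k <- ks])) V ->
  `|\sum_(t < T) \prod_(p <- V) (p%:Z %| g.[t%:Z])%Z%:R - T%:R * \prod_(p <- V) nu p|
   <= \prod_(p <- V) w p.
Proof.
move=> uV /allP VB.
have pV : all prime V.
  apply/allP => p /VB /flattenP[_ /mapP[k _ ->]].
  by rewrite mem_filter => /andP[/andP[/and3P[]]].
have dV0 : (0 < \prod_(p <- V) p)%N.
  by rewrite big_seq; apply: prodn_cond_gt0 => i /(allP pV)/prime_gt0.
have -> : \prod_(p <- V) nu p = (rho g (\prod_(p <- V) p))%:R / (\prod_(p <- V) p)%N%:R.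
  by rewrite rho_prod // !natr_prod -prodf_div.
rewrite /w -natr_prod; apply: le_trans (count_roots_approx g T dV0).
set D := (\prod_(p <- V) p)%N.
suff -> : \sum_(t < T) \prod_(p <- V) (p%:Z %| g.[t%:Z])%Z%:R
    = (\sum_(t < T) (D%:Z %| g.[t%:Z])%Z)%N%:R :> rat by [].
rewrite natr_sum; apply: eq_bigr => t _; rewrite /D dvdzE /= prod_primes_dvdn //.
elim: (V) => [|p s IH]; first by rewrite big_nil.
by rewrite big_cons IH /= dvdzE -natrM mulnb.
Qed.

Let sum_primes_le k : k \in ks ->
  1 + \sum_(p <- B k) w p <= (2 ^ (q * 2 ^ k.1.+2))%:R.
Proof.
case: k => j h; rewrite mem_ks /= => /andP[jJ hq].
set M := (2 ^ (q * 2 ^ j.+1))%N.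
have -> : (2 ^ (q * 2 ^ j.+2) = M ^ 2)%N by rewrite /M -expnM; congr expn; rewrite !expnS; lia.
apply: (@le_trans _ _ (1 + \sum_(p <- iota 0 M) w p)).
  rewrite lerD2l; apply: ler_sum_uniq_subset => [p|//|p].
  - by rewrite /w.
  - by rewrite filter_uniq ?iota_uniq.
  rewrite mem_filter => /andP[/andP[gp /eqP [ej eh]] _].
  rewrite mem_iota /= add0n; have /andP[_ hp] := lgP (good_gt0 gp).
  apply: (leq_trans hp); rewrite leq_exp2l //.
  have /andP[_] := lg_div gp; rewrite ej.
  by rewrite ltn_divLR // mulnC.
rewrite /w -natr_sum -(natrD _ 1) ler_nat.
have : (0 < M)%N by rewrite expn_gt0.
case: M => // M _; elim: M => [|M IH]; first by rewrite /= big_seq1.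
have -> : iota 0 M.+2 = iota 0 M.+1 ++ [:: M.+1] by rewrite -[M.+2]addn1 iotaD.
rewrite big_cat /= big_seq1; move: IH; rewrite -!mulnn.
by move: (\sum_(p <- _) _)%N => X; nia.
Qed.

(** Values at t < 2^(sieve_exp * 2^J) suffice for the sieve: the first summand
    comes from the error terms, that is from the sizes of the moduli, and the others
    from the number of error terms and the lower bound 2^-(J q) of the main term. *)
Definition sieve_exp := (4 * q ^ 2 * (2 * q + 3) + 2 * q + 2)%N.

(** The point of this statement is uniformity: the exponent sieve_exp q does not
    depend on the coefficients of g, nor on J. *)
Lemma exists_value_without_medium_primes :
  exists2 t, (t < 2 ^ (sieve_exp * 2 ^ J))%N &
    forall p, prime p -> (2 ^ q <= p < 2 ^ (q * 2 ^ J))%N ->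
      ~~ (p%:Z %| lead_coef g)%Z -> ~~ (p%:Z %| g.[t%:Z])%Z.
Proof.
set T := (2 ^ _)%N.
have uks : uniq ks.
  by apply: allpairs_uniq; rewrite ?iota_uniq // => -[? ?] [? ?] _ _ [-> ->].
have uB : uniq (flatten [seq B k | k <- ks]).
  by apply: uniq_flatten_fibers; rewrite ?iota_uniq.
have sks : size ks = (J * q)%N by rewrite size_allpairs !size_iota.
have w0 i : 0 <= w i by rewrite /w.
have Tbig : (1 + size ks)%:R * (\prod_(k <- ks) (1 + \sum_(i <- B k) w i) ^+ (ht k).*2.+1)
  < T%:R * 2^-1 ^+ (size ks).+1.
  rewrite exprVn ltr_pdivlMr ?exprn_gt0 // sks.
  have pr : \prod_(k <- ks) (1 + \sum_(i <- B k) w i) ^+ (ht k).*2.+1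
     <= (2 ^ (4 * q ^ 2 * (2 * q + 3) * 2 ^ J))%:R.
    apply: (@le_trans _ _ (\prod_(k <- ks)
        (2 ^ (q * 2 ^ k.1.+2 * (ht k).*2.+1))%:R)).
      rewrite !big_seq; apply: ler_prod => k kk.
      have s1 : 0 <= 1 + \sum_(i <- B k) w i by rewrite addr_ge0 // sumr_ge0.
      rewrite exprn_ge0 //= expnM natrX lerXn2r ?nnegrE // sum_primes_le //.
    rewrite -natr_prod -expn_sum ler_nat leq_exp2l //.
    rewrite big_allpairs /ht /=.
    under eq_bigr => j _ do
      rewrite big_const_seq count_predT size_iota iter_addn_0.
    (* Exact value of the sum of 2^j (2 ht + 1) over j < n, for J = n. *)
    have cl n : (\sum_(j < n) 2 ^ j * (q + (n - j.+1)).*2.+1 + (2 * q + 2 * n + 3)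
       = 2 ^ n * (2 * q + 3))%N.
      elim: n => [|n IH]; first by rewrite big_ord0; lia.
      rewrite big_ord_recl.
      have -> : (\sum_(i < n) 2 ^ (lift ord0 i) * (q + (n.+1 - (lift ord0 i).+1)).*2.+1
        = 2 * \sum_(i < n) 2 ^ i * (q + (n - i.+1)).*2.+1)%N.
        rewrite big_distrr; apply: eq_bigr => i _.
        by rewrite /= /bump /= add1n expnS mulnA subSS.
      rewrite /= expn0 expnS -mulnA -IH subn1 /= -!mul2n.
      by move: (\sum_(i < n) _)%N => X; lia.
    have -> : iota 0 J = index_iota 0 J by rewrite /index_iota subn0.
    rewrite big_mkord.
    apply: (@leq_trans (4 * q ^ 2 * \sum_(j < J) 2 ^ j * (q + (J - j.+1)).*2.+1)%N).
      rewrite big_distrr; apply: leq_sum => j _ /=; rewrite !expnS; lia.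
    rewrite -[leqRHS]mulnA leq_mul2l; apply/orP; right; rewrite mulnC.
    by rewrite -cl leq_addr.
  apply: (@le_lt_trans _ _ ((1 + J * q)%:R * (2 ^ (4 * q ^ 2 * (2 * q + 3) * 2 ^ J))%:R
       * 2 ^+ (J * q).+1)).
    by rewrite ler_wpM2r ?exprn_ge0 // ler_wpM2l.
  rewrite -natrX -!natrM ltr_nat.
  apply: (@leq_ltn_trans (2 ^ (J * q) * 2 ^ (4 * q ^ 2 * (2 * q + 3) * 2 ^ J)
       * 2 ^ (J * q).+1)%N).
    by rewrite !leq_mul2r add1n ltn_expl ?orbT.
  rewrite -!expnD ltn_exp2l // /sieve_exp.
  have : (J < 2 ^ J)%N by rewrite ltn_expl.
  rewrite -(leq_pmul2r q0) !mulnDl.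
  by move: (2 ^ J)%N => X; nia.
have [t tT ht'] := exists_unsieved (S := fun t p => (p%:Z %| g.[t%:Z])%Z) uks uB nu_ge0 w0 nu_sum ht_sum
  (@level_hyp T) Tbig.
exists t => // p pp /andP[qp pN] npl.
have gp : good p by rewrite /good pp qp.
apply: (ht' (cls p)); last first.
  by rewrite mem_filter gp eqxx mem_iota.
rewrite mem_ks /= ltn_mod q0 andbT.
have /andP[h1 _] := lg_div gp.
rewrite -(ltn_exp2l _ _ (isT : 1 < 2)%N) (leq_ltn_trans h1) // ltn_divLR //.
have /andP[h2 _] := lgP (good_gt0 gp).
by rewrite mulnC -(ltn_exp2l _ _ (isT : 1 < 2)%N) (leq_ltn_trans h2).
Qed.
End SievePoly.

(** * Polynomial values with few divisors *)

(** A divisor d of u * v is the product of gcd(d, u) and d / gcd(d, u), and the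
    latter divides v. *)
Lemma size_divisorsM u v : (0 < u)%N -> (0 < v)%N ->
  (size (divisors (u * v)) <= size (divisors u) * size (divisors v))%N.
Proof.
move=> u0 v0; rewrite -(size_allpairs muln).
apply: uniq_leq_size => [|d]; first exact: divisors_uniq.
rewrite -dvdn_divisors ?muln_gt0 ?u0 // => duv.
have g0 : (0 < gcdn d u)%N by rewrite gcdn_gt0 u0 orbT.
apply/allpairsP; exists (gcdn d u, d %/ gcdn d u)%N; rewrite /= -!dvdn_divisors //.
split; rewrite ?dvdn_gcdr //; last by rewrite mulnC divnK ?dvdn_gcdl.
rewrite -(@Gauss_dvdr _ (u %/ gcdn d u)).
  rewrite -(dvdn_pmul2r g0) divnK ?dvdn_gcdl // mulnAC divnK ?dvdn_gcdr //.
by rewrite /coprime -(eqn_pmul2r g0) muln_gcdl !divnK ?dvdn_gcdl ?dvdn_gcdr ?mul1n.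
Qed.

Lemma size_divisors_le n : (0 < n)%N -> (size (divisors n) <= n)%N.
Proof.
case: n => // n _; rewrite -[leqRHS](size_iota 1).
apply: uniq_leq_size => [|d]; first exact: divisors_uniq.
rewrite -dvdn_divisors // mem_iota => dn.
by rewrite (dvdn_gt0 _ dn) // add1n ltnS dvdn_leq.
Qed.

Lemma size_divisors_prime p : prime p -> (size (divisors p) <= 2)%N.
Proof.
move=> pp; rewrite -[leqRHS]/(size [:: 1%N; p]).
apply: uniq_leq_size => [|d]; first exact: divisors_uniq.
rewrite -dvdn_divisors ?prime_gt0 // !inE.
by case/primeP: pp => _; apply.
Qed.

(** Such an integer has at most k prime factors, counted with multiplicity. *)
Lemma size_divisors_rough z k v : (0 < v)%N -> (v < z ^ k.+1)%N ->
  (forall p, prime p -> (p %| v)%N -> (z <= p)%N) ->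
  (size (divisors v) <= 2 ^ k)%N.
Proof.
elim: k v => [|k IH] v v0 vz pz; case: (ltngtP v 1) => [|v1|->] //; try by lia.
- have := pz _ (pdiv_prime v1) (pdiv_dvd v).
  have := dvdn_leq v0 (pdiv_dvd v); lia.
- have pp := pdiv_prime v1; have e : (v = pdiv v * (v %/ pdiv v))%N.
    by rewrite mulnC divnK // pdiv_dvd.
  have w0 : (0 < v %/ pdiv v)%N by rewrite divn_gt0 ?prime_gt0 // dvdn_leq // pdiv_dvd.
  rewrite e; apply: leq_trans (size_divisorsM (prime_gt0 pp) w0) _.
  rewrite expnS leq_mul ?size_divisors_prime // IH //.
    have zp := pz _ pp (pdiv_dvd v).
    have z0 : (0 < z)%N by case: (z) vz => //; rewrite exp0n.
    by rewrite -(ltn_pmul2l z0) -expnS (leq_ltn_trans _ vz) // [leqRHS]e leq_mul2r zp orbT.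
  move=> p p_pr pv; apply: pz => //; apply: dvdn_trans pv _.
  by rewrite [X in (_ %| X)%N]e dvdn_mull.
- by rewrite expn_gt0.
Qed.

Lemma horner_norm_le (g : {poly int}) (t T : nat) : (t <= T)%N -> (0 < T)%N ->
  (absz (g.[t%:Z])%R <= (\sum_(i < size g) absz (g`_i)%R) * T ^ size g)%N.
Proof.
move=> tT T0; rewrite horner_coef.
apply: (@leq_trans (\sum_(i < size g) absz (g`_i * t%:Z ^+ i)%R)%N).
  elim: (index_enum _) => [|i s IH]; first by rewrite !big_nil.
  have absD (a b : int) : (absz (a + b)%R <= absz a + absz b)%N by lia.
  by rewrite !big_cons (leq_trans (absD _ _)) // leq_add2l.
rewrite big_distrl; apply: leq_sum => i _ /=.
rewrite abszM abszX leq_mul2l; apply/orP; right.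
apply: (@leq_trans (T ^ i)%N); last by rewrite leq_pexp2l // ltnW.
by case: (i : nat) => [//|n]; rewrite leq_exp2r.
Qed.

Lemma dvdn_by_prime_powers u r : (0 < u)%N ->
  (forall p e, prime p -> (p ^ e %| u)%N -> (p ^ e %| r)%N) -> (u %| r)%N.
Proof.
move=> u0 h; apply/dvdn_partP => // p; rewrite mem_primes => /and3P[pp _ _].
by rewrite p_part h // -p_part dvdn_part.
Qed.

(** The bound on the number of divisors below is independent of the modulus m of
    the progression; this is what allows m to be a multiple of arbitrarily many
    elements of A. *)
Section Progression.
Variables (P : {poly int}).
Hypothesis P0 : P != 0.
Let s := size P.
Let q := (4 * s)%N.
Let k := (sieve_exp q * s)%N.

(** Let g t = P(n0 + m t). The sieve provides t with g t free of primes below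
    z = 2^(q 2^J), except those dividing m, while t is at most a fixed power of z.
    With J the sum of the absolute values of the coefficients of g, which is less
    than z, the value g t is below a fixed power of z too. The part of g t composed
    of primes dividing m divides r, and the rest has boundedly many prime factors. *)
Lemma few_divisors_in_progression (r m n0 : nat) : (0 < r)%N -> (0 < m)%N ->
  ((2 ^ q)`! %| m)%N -> (lead_coef P %| m%:Z)%Z ->
  (forall t, P.[(n0 + m * t)%N%:Z] != 0) ->
  (forall t p e, prime p -> (p %| m)%N -> (p%:Z ^+ e %| P.[(n0 + m * t)%N%:Z])%Z ->
     (p ^ e %| r)%N) ->
  exists t, (size (divisors (absz (P.[(n0 + m * t)%N%:Z])%R)) <= r * 2 ^ k)%N.
Proof.
move=> r0 m0 qm lm nz hr.
have q0 : (0 < q)%N by rewrite muln_gt0 /= size_poly_gt0.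
pose g := P \Po (m%:Z *: 'X + n0%:Z%:P).
have gE (t : nat) : g.[t%:Z] = P.[(n0 + m * t)%N%:Z].
  by rewrite horner_comp !hornerE PoszD PoszM addrC.
have m0' : m%:Z != 0 by rewrite eqz_nat -lt0n.
have sX : size (m%:Z *: 'X + n0%:Z%:P) = 2%N.
  rewrite size_polyDl size_scale ?size_polyX // size_polyC; by case: (_ != _).
have lX : lead_coef (m%:Z *: 'X + n0%:Z%:P) = m%:Z.
  rewrite lead_coefDl ?lead_coefZ ?lead_coefX ?mulr1 //.
  by rewrite size_scale ?size_polyX // size_polyC; case: (_ != _).
have sg : size g = s by rewrite size_comp_poly2.
have lg : lead_coef g = lead_coef P * m%:Z ^+ s.-1.
  by rewrite lead_coef_comp ?sX // lX.
pose J := (\sum_(i < size g) absz (g`_i)%R)%N.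
have sq : (4 * size g <= q)%N by rewrite sg.
have [t tT ht] := exists_value_without_medium_primes J q0 sq.
exists t; rewrite -gE.
have := nz t; rewrite -gE -absz_eq0 -lt0n; set N := absz (g.[t%:Z])%R => N0.
rewrite -(partnC \pi(m) N0).
apply: leq_trans (size_divisorsM (part_gt0 _ _) (part_gt0 _ _)) _.
have ur : (N`_\pi(m) %| r)%N.
  apply: dvdn_by_prime_powers (part_gt0 _ _) _ => p [|e] pp pe; first by rewrite dvd1n.
  have pm : (p %| m)%N.
    have : (p \in \pi(N`_\pi(m)))%N.
      by rewrite mem_primes pp part_gt0 (dvdn_trans _ pe) // dvdn_exp.
    by rewrite pi_of_part // => /andP[_]; rewrite /= mem_primes => /and3P[].
  apply: (hr t) pp pm _; rewrite -gE dvdzE abszX /=.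
  exact: dvdn_trans pe (dvdn_part _ _).
apply: leq_mul; first by apply: leq_trans (size_divisors_le (part_gt0 _ _)) (dvdn_leq r0 ur).
apply: (@size_divisors_rough (2 ^ (q * 2 ^ J))%N); first exact: part_gt0.
  apply: (@leq_ltn_trans N); first by rewrite dvdn_leq ?dvdn_part.
  apply: (@leq_ltn_trans (J * (2 ^ (sieve_exp q * 2 ^ J)) ^ size g)%N).
    by apply: horner_norm_le; rewrite ?expn_gt0 // ltnW.
  apply: (@leq_trans (2 ^ 2 ^ J * 2 ^ (sieve_exp q * 2 ^ J * size g))%N).
    rewrite -expnM ltn_mul2r !expn_gt0 /=.
    by apply: (ltn_trans (ltn_expl J (isT : 1 < 2)%N)); apply: ltn_expl.
  rewrite -expnD -expnM leq_exp2l // sg /k.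
  have -> : (2 ^ J + sieve_exp q * 2 ^ J * s = 2 ^ J * (sieve_exp q * s).+1)%N.
    by rewrite mulnS mulnAC [(2 ^ J * _)%N]mulnC.
  by rewrite -mulnA leq_pmull.
move=> p pp; rewrite leqNgt => pv; apply/negP => pz.
have pN : (p %| N)%N := dvdn_trans pv (dvdn_part _ _).
(* A prime factor p of the second part does not divide m, so it is at least
   2^q and divides neither leading coefficient: the sieve applies if p < z. *)
have npm : ~~ (p %| m)%N.
  have : (p \in \pi(N`_\pi(m)^'))%N by rewrite mem_primes pp part_gt0.
  by rewrite pi_of_part // => /andP[_]; rewrite /= inE /= mem_primes pp m0.
have pq : (2 ^ q <= p)%N.
  rewrite leqNgt; apply: contra npm => pq; apply: dvdn_trans qm.
  by rewrite prime_dvdn_fact // ltnW.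
have npl : ~~ (p%:Z %| lead_coef g)%Z.
  rewrite lg dvdzE abszM abszX Euclid_dvdM // negb_or; apply/andP; split.
    by apply: contra npm => pl; move: lm; rewrite dvdzE => /(dvdn_trans pl).
  by case: (s.-1) => [|e]; rewrite ?Euclid_dvdX ?Euclid_dvd1 ?negb_and ?npm.
by have := ht p pp; rewrite pq pz => /(_ isT npl); rewrite dvdzE pN.
Qed.
End Progression.

Lemma eventually_nonroot (P : {poly int}) : P != 0 ->
  exists N, forall n, (N <= n)%N -> P.[n%:Z] != 0.
Proof.
elim: {P}(size P) {-2}P (leqnn (size P)) => [|s IH] P.
  by rewrite leqn0 size_poly_eq0 => ->.
move=> sP P0; case: (pselect (exists a : nat, root P a%:Z)) => [[a ra]|nr]; last first.
  by exists 0%N => n _; apply/negP => rn; apply: nr; exists n.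
have [Q e] := factor_theorem _ _ ra.
have Q0 : Q != 0 by apply: contraNneq P0 => Q0; rewrite e Q0 mul0r.
have [N hN] : exists N, forall n, (N <= n)%N -> Q.[n%:Z] != 0.
  by apply: IH => //; move: sP; rewrite e size_Mmonic ?monicXsubC // size_XsubC addn2.
exists (maxn N a.+1) => n; rewrite geq_max => /andP[/hN nQ an].
by rewrite e hornerM mulf_neq0 // hornerXsubC subr_eq0; apply: contraTneq an => -[->]; rewrite ltnn.
Qed.

(** Take m = |r| m', where m' is a multiple of L, of r, of the small primes and of
    the leading coefficient of P, and a residue class on which m divides H. A prime
    p dividing m divides m', so H is divisible on this class by p to a power
    exceeding its multiplicity in r. By U H + V P = r, the power of p dividing P
    divides r. *)
Lemma few_divisors_of_coprime_values (P H U V : {poly int}) (r : int) :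
  P != 0 -> r != 0 -> U * H + V * P = r%:P ->
  (forall m : int, 1 <= m -> exists n : int, (H.[n] = 0 %[mod m])%Z) ->
  exists C : nat, forall L N, (0 < L)%N -> exists n,
    [/\ (N <= n)%N, (L%:Z %| H.[n%:Z])%Z, P.[n%:Z] != 0 &
        (size (divisors (absz (P.[n%:Z])%R)) <= C)%N].
Proof.
move=> P0 r0 UV Hint; set s := size P; set q := (4 * s)%N.
exists (absz r * 2 ^ (sieve_exp q * s))%N => L N L0.
have [N1 hN1] := eventually_nonroot P0.
pose m' := (absz r * L * (2 ^ q)`! * absz (lead_coef P))%N.
pose m := (absz r * m')%N.
have m'0 : (0 < m')%N by rewrite !muln_gt0 L0 fact_gt0 !absz_gt0 r0 lead_coef_eq0 P0.
have m0 : (0 < m)%N by rewrite muln_gt0 absz_gt0 r0.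
have [z hz] := Hint m%:Z m0.
(* The summand m * (N + N1) moves the progression beyond N and all roots. *)
pose n0 := (absz (z %% m%:Z)%Z + m * (N + N1))%N.
have Hm t : (m%:Z %| H.[(n0 + m * t)%N%:Z])%Z.
  rewrite (@dvdz_horner_mod _ _ _ z); last first.
    have mz : m%:Z != 0 by rewrite eqz_nat -lt0n.
    have az : (absz (z %% m%:Z)%Z)%:Z = (z %% m%:Z)%Z.
      by rewrite gez0_abs // modz_ge0.
    rewrite /n0 !PoszD !PoszM az.
    have -> : forall a b : int, (z %% m%:Z)%Z + m%:Z * a + m%:Z * b - z
        = (a + b - (z %/ m%:Z)%Z) * m%:Z.
      by move=> a b; rewrite [X in _ - X](divz_eq z m%:Z); ring.
    exact: dvdz_mull.
  by rewrite /dvdz; apply/dvdz_mod0P; rewrite hz mod0z.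
have big t : (N + N1 <= n0 + m * t)%N.
  rewrite /n0 -addnA; apply: leq_trans (leq_addl _ _); apply: leq_trans (leq_addr _ _).
  by rewrite leq_pmull.
have nz t : P.[(n0 + m * t)%N%:Z] != 0.
  by apply: hN1; apply: leq_trans (big t); rewrite leq_addl.
have rm' : (absz r %| m')%N by rewrite /m' -!mulnA dvdn_mulr.
have [t ht] : exists t, (size (divisors (absz (P.[(n0 + m * t)%N%:Z])%R)) <=
    absz r * 2 ^ (sieve_exp q * s))%N.
  apply: few_divisors_in_progression => //.
  - by rewrite absz_gt0.
  - by rewrite /m /m' dvdn_mull // dvdn_mulr // dvdn_mull.
  - by rewrite dvdzE /= /m /m' !dvdn_mull.
  move=> t p e pp pm pe; rewrite pfactor_dvdn ?absz_gt0 // leqNgt; apply/negP => lt.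
  set v := logn p (absz r) in lt.
  have pm' : (p %| m')%N.
    by move: pm; rewrite Euclid_dvdM // => /orP[/dvdn_trans->|].
  have pvm : (p ^ v.+1 %| m)%N by rewrite expnSr dvdn_mul // /v -p_part dvdn_part.
  have pvr : (p ^ v.+1 %| absz r)%N.
    have : ((p ^ v.+1)%N%:Z %| r)%Z.
      rewrite -[r](hornerC r (n0 + m * t)%N%:Z) -UV hornerD !hornerM.
      apply: rpredD; apply: dvdz_mull.
        by apply: dvdz_trans (Hm t); rewrite dvdzE.
      apply: dvdz_trans pe; rewrite dvdzE abszX /=; exact: dvdn_exp2l.
    by rewrite dvdzE.
  by move: pvr; rewrite pfactor_dvdn ?absz_gt0 // ltnn.
exists (n0 + m * t)%N; split => //.
  by apply: leq_trans (big t); rewrite leq_addr.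
have Lm : (L %| m)%N.
  by rewrite dvdn_mull // dvdn_mulr // dvdn_mulr // dvdn_mull.
by apply: dvdz_trans (Hm t); rewrite dvdzE.
Qed.

(** * Counting divisors in a set *)

(** Clearing denominators in a Bezout relation over the rationals. *)
Lemma coprimep_polyQ_Bezout (H P : {poly int}) :
  coprimep (polyQ H) (polyQ P) ->
  exists U V : {poly int}, exists2 r : int, r != 0 & U * H + V * P = r%:P.
Proof.
move=> /Bezout_eq1_coprimepP[[u v] /=].
have [U [a a0 ->]] := rat_poly_scale u; have [V [b b0 ->]] := rat_poly_scale v.
move=> e; exists (b *: U), (a *: V), (a * b); first by rewrite mulf_neq0.
have inj : injective (map_poly (intr : int -> rat)).
  by apply: map_inj_poly => //; exact: intr_inj.
apply: inj; rewrite rmorphD !rmorphM /= !map_polyZ map_polyC /=.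
have a0' : a%:~R != 0 :> rat by rewrite intr_eq0.
have b0' : b%:~R != 0 :> rat by rewrite intr_eq0.
rewrite -[RHS]mulr1 -e mulrDr /polyQ.
rewrite -!mul_polyC (map_polyC _ b) /=.
have cK (c : rat) : c != 0 -> c%:P * c^-1%:P = 1 by move=> c0; rewrite -polyCM mulfV.
rewrite !mulrA [X in _ = X * _ * _ + _]mulrAC cK // mul1r.
by rewrite -[X in _ = _ + X * _ * _]mulrA cK // mulr1.
Qed.

Lemma counting_ge_size (R : realType) (T : choiceType) (A : set T) (s : seq T) :
  uniq s -> (forall x, x \in s -> A x) ->
  ((size s)%:R%:E <= counting A :> \bar R)%E.
Proof.
move=> us sA; rewrite /counting; case: asboolP => [fA|_]; last by rewrite leey.
rewrite lee_fin ler_nat; apply: uniq_leq_size => // x /sA Ax.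
by rewrite in_fset_set // inE.
Qed.

Lemma counting_le_size (R : realType) (T : choiceType) (A : set T) (s : seq T) :
  (forall x, A x -> x \in s) -> (counting A <= (size s)%:R%:E :> \bar R)%E.
Proof.
move=> As; have fA : finite_set A.
  by apply: (@sub_finite_set _ _ [set` s]) => // x /As.
rewrite /counting asboolT // lee_fin ler_nat; apply: uniq_leq_size => // x.
by rewrite in_fset_set // inE => /As.
Qed.

Lemma infinite_nat_unbounded (S : set nat) :
  (forall N, exists2 n, (N <= n)%N & S n) -> infinite_set S.
Proof.
move=> h /finite_seqP[s eS]; have [n + Sn] := h (\max_(i <- s) i).+1.
have ns : n \in s by move: Sn; rewrite eS.
by rewrite ltnNge (big_rem n ns) /= leq_maxl.
Qed.

(** Only the existence of the integers n in [core] is used from here on, for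
    finite and infinite A alike. *)
Section Gap.
Variables (R : realType) (s : nat) (G : 'I_s -> {poly int}).
Variables (H F : {poly int}) (C : nat) (A : set nat).
Let P := \prod_(j < s) G j.
Hypothesis core : forall L N, (0 < L)%N -> exists n,
    [/\ (N <= n)%N, (L%:Z %| H.[n%:Z])%Z, P.[n%:Z] != 0 &
        (size (divisors (absz (P.[n%:Z])%R)) <= C)%N].
Hypothesis HF : dvd_Zpoly H F.
Hypothesis A0 : forall a, A a -> (0 < a)%N.

Lemma max_dA_le (n : nat) : P.[n%:Z] != 0 ->
  (size (divisors (absz (P.[n%:Z])%R)) <= C)%N -> (max_dA R G A n <= C%:R%:E)%E.
Proof.
move=> Pn dP; rewrite /max_dA; apply: (big_ind (fun x => (x <= C%:R%:E)%E)) => [|x y hx hy|j _].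
- exact: leNye.
- by rewrite ge_max hx.
apply: (@le_trans _ _ (size (divisors (absz (P.[n%:Z])%R)))%:R%:E); last first.
  by rewrite lee_fin ler_nat.
apply: counting_le_size => a [Aa aG]; rewrite -dvdn_divisors ?absz_gt0 //.
have : (a%:Z %| P.[n%:Z])%Z.
  by rewrite /P (bigD1 j) //= hornerM; apply: dvdz_mulr.
by rewrite dvdzE.
Qed.

(** Let L be the product of the elements of l; when L divides H(n), they all
    divide F(n). *)
Lemma dA_large_with_few_competitors (l : seq nat) (N : nat) : uniq l ->
  (forall a, a \in l -> A a) -> exists n,
  [/\ (N <= n)%N, \prod_(j < s) (G j).[n%:Z] != 0,
      ((size l)%:R%:E <= dA R A F.[n%:Z])%E & (max_dA R G A n <= C%:R%:E)%E].
Proof.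
move=> ul lA; have L0 : (0 < \prod_(a <- l) a)%N.
  by rewrite big_seq; apply: prodn_cond_gt0 => a /lA/A0.
have [n [Nn Ln Pn dn]] := core N L0.
exists n; split => //; [by move: Pn; rewrite horner_prod | | exact: max_dA_le].
apply: counting_ge_size => // a al; split; first exact: lA.
have [Q ->] := HF; rewrite hornerM; apply: dvdz_mull; apply: dvdz_trans Ln.
by rewrite dvdzE /= (big_rem a al) /= dvdn_mulr.
Qed.

Lemma dA_gap_large (M N : nat) : infinite_set A -> exists n,
  [/\ (N <= n)%N, \prod_(j < s) (G j).[n%:Z] != 0 & (M%:R%:E <= dA_gap R F G A n)%E].
Proof.
move=> /(@infinite_set_fset _ _ (M + C)%N)[B BA cB].
have [n [Nn Pn d1 d2]] :=
  dA_large_with_few_competitors N (finmap.fset_uniq B) (fun a h => BA a h).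
exists n; split => //; rewrite /dA_gap.
apply: le_trans (leeB d1 d2).
by rewrite -EFinB lee_fin lerBrDr -natrD ler_nat.
Qed.

Lemma limn_esup_gap : infinite_set A ->
  limn_esup (fun n : nat => dA_gap R F G A n.+1) = +oo%E.
Proof.
move=> iA; rewrite limn_esup_lim.
suff -> : esups (fun n : nat => dA_gap R F G A n.+1) = cst +oo%E by rewrite lim_cst.
apply/funext => N /=; apply/eqyP => x x0.
have [n [Nn _ h]] := dA_gap_large (Num.bound x) N.+1 iA.
apply: (@le_trans _ _ (dA_gap R F G A n)).
  apply: le_trans h; rewrite lee_fin ltW //.
  exact: archi_boundP (ltW x0).
apply: ereal_sup_ubound; exists n.-1 => /=; first by case: n Nn {h}.
by rewrite prednK // (leq_trans _ Nn).
Qed.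

Lemma gap_subsequence : infinite_set A ->
  exists v : nat -> nat,
   [/\ {homo v : i j / (i < j)%N},
     forall k, (0 < v k)%N /\ \prod_(j < s) (G j).[(v k)%:Z] != 0 &
     dA_gap R F G A (v k) @[k --> \oo] --> +oo%E].
Proof.
move=> iA; have [f hf] := choice (fun MN : nat * nat => dA_gap_large MN.1 MN.2 iA).
pose v := fix v k := if k is k'.+1 then f (k, (v k').+1) else f (0%N, 1%N).
have vS k : (v k < v k.+1)%N by have [] := hf (k.+1, (v k).+1).
have vk k : [/\ (0 < v k)%N, \prod_(j < s) (G j).[(v k)%:Z] != 0 &
    (k%:R%:E <= dA_gap R F G A (v k))%E].
  case: k => [|k]; first by have [] := hf (0%N, 1%N).
  by have [/= h1 h2 h3] := hf (k.+1, (v k).+1); split=> //; apply: leq_trans h1.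
exists v; split.
- exact: (homo_ltn ltn_trans vS).
- by move=> k; have [] := vk k.
apply/cvgeyPge => x; near=> k.
have [_ _] := vk k; apply: le_trans; rewrite lee_fin.
by near: k; exact: nbhs_infty_ger.
Unshelve. all: by end_near. Qed.
End Gap.

Theorem theorem1p2 (s : nat) (hs : (1 <= s)%N)
    (G : 'I_s -> {poly int}) (hG : forall j, G j != 0)
    (H : {poly int}) (hHnc : (1 < size H)%N) (hHint : intersective H)
    (hgcd : coprimep (polyQ H) (polyQ (\prod_(j < s) G j))) :
  exists C : nat, forall (R : realType) (F : {poly int}),
    F != 0 -> dvd_Zpoly H F ->
    forall A : set nat, (forall a, A a -> (0 < a)%N) ->
    (finite_set A -> (C%:R%:E < counting A :> \bar R)%E ->
       infinite_set [set n : nat | [/\ (0 < n)%N,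
         \prod_(j < s) (G j).[n%:Z] != 0 &
         (max_dA R G A n < dA R A F.[n%:Z])%E]]) /\
    (infinite_set A ->
       limn_esup (fun n : nat => dA_gap R F G A n.+1) = +oo%E /\
       exists v : nat -> nat,
         [/\ {homo v : i j / (i < j)%N},
             forall k, (0 < v k)%N /\ \prod_(j < s) (G j).[(v k)%:Z] != 0 &
             dA_gap R F G A (v k) @[k --> \oo] --> +oo%E]).
Proof.
have [U [V [r r0 UV]]] := coprimep_polyQ_Bezout hgcd.
have P0 : \prod_(j < s) G j != 0 by apply/prodf_neq0 => j _.
have [C core] := few_divisors_of_coprime_values P0 r0 UV hHint.
exists C => R F _ HF A A0; split => [fA cA|iA].
  apply: infinite_nat_unbounded => N.
  have [n [Nn Pn d1 d2]] := dA_large_with_few_competitors R core HF A0 N.+1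
    (finmap.fset_uniq (fset_set A)) (fun a h => set_mem (etrans (esym (in_fset_set fA a)) h)).
  exists n; first exact: ltnW.
  split=> //; first exact: leq_ltn_trans Nn.
  apply: (le_lt_trans d2); apply: lt_le_trans d1.
  by move: cA; rewrite /counting asboolT.
by split; [exact: limn_esup_gap core HF A0 iA | exact: gap_subsequence core HF A0 iA].
Qed.
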